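(* Suppose assumptions A0–A5 (all stated in the context) hold, let $\{x_k\}$ be an arbitrary sequence generated by the PIAG method, and let the stepsize $\alpha>0$ be sufficiently small. Then: (i) $\sum_{i=0}^\infty\|x_{i+1}-x_i\|<+\infty$; (ii) $\{x_k\}$ is R-linearly convergent.
   Context: Problem: minimize $F(x)=\sum_{i=1}^N f_i(x)+h(x)$ over $x\in\mathbb{R}^d$, where the $f_i:\mathbb{R}^d\to\mathbb{R}$ are differentiable and possibly nonconvex, and $h$ is convex and possibly nonsmooth. Write $f=\sum_{i=1}^N f_i$. $\|\cdot\|$ is the Euclidean norm and $\langle\cdot,\cdot\rangle$ the inner product. A differentiable function $\phi$ is $M$-smooth if $\|\nabla \phi(x)-\nabla \phi(y)\|\le M\|x-y\|$ for all $x,y\in\mathbb{R}^d$. PIAG (proximal incremental aggregated gradient) method with stepsize $\alpha$ and nonnegative integer delays $\tau_k^i$: $$g_k=\sum_{i=1}^N\nabla f_i(x_{k-\tau_k^i}),\qquad x_{k+1}=\arg\min_{x\in\mathbb{R}^d}\Big\{h(x)+\langle g_k,x-x_k\rangle+\tfrac{1}{2\alpha}\|x-x_k\|^2\Big\},\qquad k\ge0,$$ with the convention $x_{-k}=x_0$ for $k\ge1$. $\operatorname{Prox}_{\phi}(y)=\arg\min_x\{\phi(x)+\frac12\|x-y\|^2\}$. The set of stationary points is $\mathcal{X}=\{x\in\mathbb{R}^d:0\in\nabla f(x)+\partial h(x)\}$, where $\partial h$ is the convex subdifferential. For a nonempty closed set $\mathcal{C}$, $\operatorname{dist}(x,\mathcal{C})=\inf_{y\in\mathcal{C}}\|x-y\|$.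 A sequence $\{x_k\}$ is R-linearly convergent to $x^\ast$ if $\limsup_{k\to\infty}\|x_k-x^\ast\|^{1/k}<1$, and R-linearly convergent if this holds for some $x^\ast$. Assumptions: A0. $F$ is bounded below. A1. For each $i=1,\dots,N$ there is a decomposition $f_i=f_i^{(1)}-f_i^{(2)}$ where $f_i^{(1)}$ is convex and $L_i$-smooth and $f_i^{(2)}$ is convex and $l_i$-smooth. Put $L=\sum_{i=1}^N L_i$, $l=\sum_{i=1}^N l_i$. Also $L_i\ge l_i$ (thus $f_i$ is $L_i$-smooth). A2. $h:\mathbb{R}^d\to(-\infty,+\infty]$ is proper, closed, convex, and $\partial h(x)\ne\emptyset$ for all $x$ with $h(x)<\infty$. A3. There is a nonnegative integer $\tau$ such that $\tau_k^i\in\{0,1,\dots,\tau\}$ for all $k\ge1$ and $i\in\{1,\dots,N\}$. A4 (proximal error bound condition). For any $\zeta\ge\inf_{x\in\mathbb{R}^d}F(x)$ there exist $\epsilon>0$ and $c_0>0$ such that $\operatorname{dist}(x,\mathcal{X})\le c_0\|\operatorname{Prox}_{\frac1L h}(x-\frac1L\nabla f(x))-x\|$ whenever $\|\operatorname{Prox}_{\frac1L h}(x-\frac1L\nabla f(x))-x\|<\epsilon$ and $F(x)\le\zeta$. A5. There exists $\delta>0$ such that $\|x-y\|\ge\delta$ whenever $x,y\in\mathcal{X}$ and $F(x)\ne F(y)$. *)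

(* Defs.v *)
From HB Require Import structures.
From mathcomp Require Import all_boot all_order all_algebra.
From mathcomp Require Import all_classical all_reals all_analysis.
Import Order.TTheory GRing.Theory Num.Theory numFieldNormedType.Exports.

Set Implicit Arguments.
Unset Strict Implicit.
Unset Printing Implicit Defensive.

Local Open Scope classical_set_scope.
Local Open Scope ring_scope.

Section Piag.
Context {R : realType} {d : nat}.
Implicit Types (x y u v g : 'rV[R]_d) (p : 'rV[R]_d -> R)
  (phi h : 'rV[R]_d -> \bar R).

Definition dot u v : R := \sum_(j < d) u 0 j * v 0 j.

(* The library norm `|u| on 'rV[R]_d is the sup norm. It induces the same
   topology and the same notion of differentiability as the Euclidean norm, but
   every metric quantity below has to use [enorm]. *)
Definition enorm u : R := Num.sqrt (dot u u).

(* The gradient with respect to [dot]; only used for differentiable [p], where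
   the directional derivative ['D_v p x] is [dot (grad p x) v]. *)
Definition grad p x : 'rV[R]_d := \row_(j < d) 'D_(delta_mx 0 j) p x.

Definition is_smooth (M : R) p : Prop :=
  (forall x, differentiable p x) /\
  (forall x y, enorm (grad p x - grad p y) <= M * enorm (x - y)).

Definition smooth_dc (M m : R) p : Prop :=
  exists p1 p2 : 'rV[R]_d -> R,
    [/\ convex_function setT p1, is_smooth M p1,
        convex_function setT p2, is_smooth m p2 &
        forall x, p x = p1 x - p2 x].

Definition eproper h : Prop :=
  (forall x, h x != -oo%E) /\ (exists x, (h x < +oo)%E).

(* For proper [h] only [0 * +oo] could be ambiguous; in \bar R it is 0. *)
Definition econvex h : Prop :=
  forall x y (t : R), 0 <= t <= 1 ->
    (h (t *: x + (1 - t) *: y)%R <= t%:E * h x + (1 - t)%:E * h y)%E.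

(* For proper [h] this is empty outside the domain of [h]. *)
Definition subdiff h x : set 'rV[R]_d :=
  [set v | forall y, (h x + (dot v (y - x))%:E <= h y)%E].

Definition argmin phi : set 'rV[R]_d := [set x | forall y, (phi x <= phi y)%E].

(* For proper, closed and convex [phi] the argmin is a singleton, so that the
   default value of [xget] is irrelevant. *)
Definition prox phi y : 'rV[R]_d :=
  xget 0 (argmin (fun x => (phi x + (2^-1 * enorm (x - y) ^+ 2)%:E)%E)).

(* Extended-valued, so that the distance to the empty set is +oo. *)
Definition edist x (C : set 'rV[R]_d) : \bar R :=
  ereal_inf [set (enorm (x - y))%:E | y in C].

Definition objective p h x : \bar R := ((p x)%:E + h x)%E.

Definition stationary p h : set 'rV[R]_d :=
  [set x | [set grad p x + v | v in subdiff h x] 0].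

Definition bounded_below phi : Prop := exists m : R, forall x, (m%:E <= phi x)%E.

Definition prox_residual (L : R) p h x : R :=
  enorm (prox (fun z => (L^-1)%:E * h z)%E (x - L^-1 *: grad p x) - x).

Definition proximal_error_bound (L : R) p h : Prop :=
  forall zeta : R, (ereal_inf (range (objective p h)) <= zeta%:E)%E ->
  exists eps c0 : R, [/\ 0 < eps, 0 < c0 &
    forall x, prox_residual L p h x < eps -> (objective p h x <= zeta%:E)%E ->
      (edist x (stationary p h) <= (c0 * prox_residual L p h x)%:E)%E].

Definition stationary_separation p h : Prop :=
  exists2 delta : R, 0 < delta &
    forall x y, stationary p h x -> stationary p h y ->
      objective p h x <> objective p h y -> delta <= enorm (x - y).

(* The truncated subtraction on nat implements the convention x_{-k} = x_0. *)
Definition piag (N : nat) (f : 'I_N -> 'rV[R]_d -> R) h (alpha : R)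
    (delay : nat -> 'I_N -> nat) (xs : nat -> 'rV[R]_d) : Prop :=
  forall k : nat,
    let g := \sum_(i < N) grad (f i) (xs (k - delay k i)%N) in
    argmin (fun x => (h x + (dot g (x - xs k)
                        + (2 * alpha)^-1 * enorm (x - xs k) ^+ 2)%:E)%E)
      (xs k.+1).

Definition R_linearly_convergent_to (xs : nat -> 'rV[R]_d) (xstar : 'rV[R]_d) :
    Prop :=
  (limn_esup (fun k => (enorm (xs k - xstar) `^ (k%:R^-1))%:E) < 1%:E)%E.

Definition R_linearly_convergent (xs : nat -> 'rV[R]_d) : Prop :=
  exists xstar, R_linearly_convergent_to xs xstar.

End Piag.

(* Main.v *)
Require Import Defs.
From mathcomp Require Import all_boot all_order all_algebra.
From mathcomp Require Import all_classical all_reals all_analysis.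
From mathcomp Require Import ring lra.
Import Order.TTheory GRing.Theory Num.Theory numFieldNormedType.Exports.

Set Implicit Arguments.
Unset Strict Implicit.
Unset Printing Implicit Defensive.
Local Open Scope classical_set_scope.
Local Open Scope ring_scope.

(* Let delta_k = |x_k - x_(k-1)|, let S_k be the sum of the last tau + 1 of the
   delta's, and let M be a Lipschitz constant of grad f. Convexity of h and the
   descent lemma make F(x_k) plus a weighted sum of the last tau squares delta^2
   a Lyapunov function V_k with V_(k+1) <= V_k - M delta_(k+1)^2 as soon as
   alpha M (tau + 2) <= 1, so S_k -> 0. The optimality condition of the PIAG
   step bounds the proximal residual of x_k by O(S_k), so the error bound yields
   stationary points y_k with |x_k - y_k| = O(S_k); consecutive y_k become
   close, and by separation F(y_k) is eventually a constant Fbar. Then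
   0 <= V_k - Fbar = O(S_k^2), which with the decrease of V gives
   V_(k+tau+1) - Fbar <= rho (V_k - Fbar) for some rho < 1. *)

(** * Euclidean inner product and norm *)

Section Euclid.
Context {R : realType} {d : nat}.
Implicit Types (u v w x y : 'rV[R]_d) (c : R).

Lemma dotC u v : dot u v = dot v u.
Proof. by apply: eq_bigr => j _; rewrite mulrC. Qed.
Lemma dotDl u v w : dot (u + v) w = dot u w + dot v w.
Proof. by rewrite -big_split; apply: eq_bigr => j _; rewrite mxE mulrDl. Qed.
Lemma dotZl c u v : dot (c *: u) v = c * dot u v.
Proof. by rewrite mulr_sumr; apply: eq_bigr => j _; rewrite mxE mulrA. Qed.
Lemma dotNl u v : dot (- u) v = - dot u v.
Proof. by rewrite -scaleN1r dotZl mulN1r. Qed.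
Lemma dotBl u v w : dot (u - v) w = dot u w - dot v w.
Proof. by rewrite dotDl dotNl. Qed.
Lemma dotDr u v w : dot w (u + v) = dot w u + dot w v.
Proof. by rewrite !(dotC w) dotDl. Qed.
Lemma dotZr c u v : dot v (c *: u) = c * dot v u.
Proof. by rewrite !(dotC v) dotZl. Qed.
Lemma dotNr u v : dot v (- u) = - dot v u.
Proof. by rewrite !(dotC v) dotNl. Qed.
Lemma dotBr u v w : dot w (u - v) = dot w u - dot w v.
Proof. by rewrite dotDr dotNr. Qed.
Lemma dot0l v : dot 0 v = 0.
Proof. by rewrite -(scale0r 0) dotZl mul0r. Qed.
Lemma dot_ge0 u : 0 <= dot u u.
Proof. by apply: sumr_ge0 => j _; rewrite -expr2 sqr_ge0. Qed.

Lemma enorm_ge0 u : 0 <= enorm u.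
Proof. exact: sqrtr_ge0. Qed.
Lemma enorm_sqr u : enorm u ^+ 2 = dot u u.
Proof. by rewrite sqr_sqrtr // dot_ge0. Qed.
Lemma enorm0 : enorm (0 : 'rV[R]_d) = 0.
Proof. by rewrite /enorm dot0l sqrtr0. Qed.

Lemma enorm_coord u j : `|u 0 j| <= enorm u.
Proof.
rewrite -sqrtr_sqr ler_sqrt ?sqr_ge0 ?dot_ge0 //.
rewrite /dot (bigD1 j) //= -expr2 lerDl.
by apply: sumr_ge0 => i _; rewrite -expr2 sqr_ge0.
Qed.

Lemma enorm_eq0 u : enorm u = 0 -> u = 0.
Proof.
move=> u0; apply/rowP => j; rewrite mxE; apply/eqP.
by rewrite -normr_le0 -u0 enorm_coord.
Qed.

(** Cauchy-Schwarz, from expanding the square of [enorm v *: u - enorm u *: v] and dividing by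
    [enorm u * enorm v]. *)
Lemma dot_le u v : dot u v <= enorm u * enorm v.
Proof.
have [/eqP/enorm_eq0 ->|nv] := boolP (enorm v == 0).
  by rewrite dotC dot0l enorm0 mulr0.
have [/eqP/enorm_eq0 ->|nu] := boolP (enorm u == 0).
  by rewrite dot0l enorm0 mul0r.
have u0 : 0 < enorm u by rewrite lt_neqAle eq_sym nu enorm_ge0.
have v0 : 0 < enorm v by rewrite lt_neqAle eq_sym nv enorm_ge0.
have := dot_ge0 (enorm v *: u - enorm u *: v).
rewrite dotBl !dotBr !dotZl !dotZr -!enorm_sqr (dotC v u) => H.
have : 0 <= (enorm u * enorm v) * (enorm u * enorm v - dot u v) by nra.
by rewrite pmulr_rge0 ?mulr_gt0 // subr_ge0.
Qed.

Lemma enormZ c u : enorm (c *: u) = `|c| * enorm u.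
Proof. by rewrite /enorm dotZl dotZr mulrA -expr2 sqrtrM ?sqr_ge0 // sqrtr_sqr. Qed.
Lemma enormN u : enorm (- u) = enorm u.
Proof. by rewrite -scaleN1r enormZ normrN1 mul1r. Qed.
Lemma enormBC u v : enorm (u - v) = enorm (v - u).
Proof. by rewrite -enormN opprB. Qed.

Lemma ler_enormD u v : enorm (u + v) <= enorm u + enorm v.
Proof.
rewrite -ler_sqr ?nnegrE ?addr_ge0 ?enorm_ge0 // enorm_sqr dotDl !dotDr.
have := dot_le u v; rewrite (dotC v u) -!enorm_sqr; nra.
Qed.

Lemma dot_norm_le u v : `|dot u v| <= enorm u * enorm v.
Proof. by rewrite ler_norml dot_le andbT lerNl -dotNl -(enormN u) dot_le. Qed.

Lemma ler_enorm_sum (I : finType) (P : pred I) (F : I -> 'rV[R]_d) :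
  enorm (\sum_(i | P i) F i) <= \sum_(i | P i) enorm (F i).
Proof.
elim/big_ind2 : _ => [|u a v b ua vb|//]; first by rewrite enorm0.
exact: le_trans (ler_enormD _ _) (lerD ua vb).
Qed.

Lemma ler_enormB_trans v u w : enorm (u - w) <= enorm (u - v) + enorm (v - w).
Proof. by rewrite -{1}(subrK v u) -addrA ler_enormD. Qed.

Lemma enorm_le_sum u : enorm u <= \sum_(j < d) `|u 0 j|.
Proof.
rewrite {1}[u]row_sum_delta (le_trans (ler_enorm_sum _ _))//.
apply: ler_sum => j _; rewrite enormZ.
suff -> : enorm (delta_mx 0 j : 'rV[R]_d) = 1 by rewrite mulr1.
rewrite /enorm /dot (bigD1 j)//= big1 ?mxE ?eqxx ?mulr1 ?addr0 ?sqrtr1 //.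
by move=> i ij; rewrite !mxE (negPf ij) andbF mulr0.
Qed.

End Euclid.

(** * Gradients and the first-order Taylor estimate *)

Section Gradient.
Context {R : realType} {d : nat}.
Implicit Types (u v w x y : 'rV[R]_d) (p q : 'rV[R]_d -> R).

Lemma derive_dot_grad p x v : differentiable p x -> 'D_v p x = dot (grad p x) v.
Proof.
move=> px; rewrite deriveE // {1}[v]row_sum_delta linear_sum.
by apply: eq_bigr => j _; rewrite linearZ /= mxE deriveE // mulrC.
Qed.

Lemma gradB p q x : differentiable p x -> differentiable q x ->
  grad (fun z => p z - q z) x = grad p x - grad q x.
Proof.
by move=> px qx; apply/rowP => j; rewrite !mxE deriveB //; apply: diff_derivable.
Qed.

Lemma differentiable_sumf (n : nat) (f : 'I_n -> 'rV[R]_d -> R) x :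
  (forall i, differentiable (f i) x) ->
  differentiable (fun z => \sum_(i < n) f i z) x.
Proof.
move=> fx; have -> : (fun z => \sum_(i < n) f i z) = \sum_(i < n) f i.
  by apply/funext => z; rewrite fct_sumE.
by apply: differentiable_sum.
Qed.

Lemma grad_sum (n : nat) (f : 'I_n -> 'rV[R]_d -> R) x :
  (forall i, differentiable (f i) x) ->
  grad (fun z => \sum_(i < n) f i z) x = \sum_(i < n) grad (f i) x.
Proof.
move=> fx; have -> : (fun z => \sum_(i < n) f i z) = \sum_(i < n) f i.
  by apply/funext => z; rewrite fct_sumE.
apply/rowP => j; rewrite summxE mxE derive_sum; last first.
  by move=> i; apply: diff_derivable.
by apply: eq_bigr => i _; rewrite mxE.
Qed.

(* The mean value theorem costs a factor 2 with respect to the integral form,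
   which only changes the admissible stepsizes. *)
Lemma smooth_taylor (M : R) p x y : 0 <= M -> is_smooth M p ->
  `|p y - p x - dot (grad p x) (y - x)| <= M * enorm (y - x) ^+ 2.
Proof.
move=> M0 [pd pM]; set v := y - x.
pose g (t : R) := p (t *: v + x).
have gd t : is_derive t (1 : R) g (dot (grad p (t *: v + x)) v).
  have E : (fun h => h^-1 *: ((g \o shift t) (h *: (1 : R)) - g t)) =
     (fun h => h^-1 *: ((p \o shift (t *: v + x)) (h *: v) - p (t *: v + x))).
    apply/funext => h; rewrite /g /= /shift /=; congr (_ *: (p _ - _)).
    by rewrite addrA -scalerDl /GRing.scale /= mulr1.
  have dv : derivable p (t *: v + x) v by exact: diff_derivable.
  apply: DeriveDef; first by rewrite /derivable E.
  by rewrite -derive_dot_grad // /derive E.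
have [|c c01] := MVT (f := g) (df := fun t => dot (grad p (t *: v + x)) v) (@ltr01 R) (fun t _ => gd t).
  apply: derivable_within_continuous => t _; exact: ex_derive.
rewrite /g scale1r scale0r add0r subr0 mulr1 subrK => ->.
rewrite -dotBl (le_trans (dot_norm_le _ _))// expr2 mulrA ler_wpM2r ?enorm_ge0 //.
apply: le_trans (pM _ _) _; rewrite addrK enormZ ler_wpM2l // ler_piMl ?enorm_ge0 //.
by move: c01; rewrite in_itv /= => /andP[c0 c1]; rewrite ger0_norm ltW.
Qed.

End Gradient.

(** * Subgradients and the proximal map *)

Section Prox.
Context {R : realType} {d : nat}.
Implicit Types (u v w x y z a b : 'rV[R]_d) (h : 'rV[R]_d -> \bar R) (s c : R).

Lemma subdiff_fin h x v : eproper h -> subdiff h x v -> h x \is a fin_num.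
Proof.
move=> [hNy [y hy]] xv; rewrite fin_numE hNy /=; apply/negP => /eqP hx.
by have := xv y; rewrite hx addye // => /(lt_le_trans hy); rewrite ltxx.
Qed.

Lemma subdiff_fine h x y v : eproper h -> subdiff h x v -> (h y < +oo)%E ->
  fine (h x) + dot v (y - x) <= fine (h y).
Proof.
move=> hp xv hy; have := xv y.
have hyf : h y \is a fin_num by rewrite fin_numE hp.1 -ltey.
by rewrite -(fineK (subdiff_fin hp xv)) -(fineK hyf) -EFinD lee_fin.
Qed.

(** Replaces a passage to the limit t -> 0: if A < 0, the admissible value t = -A / (1 + B - A)
    makes A + t B negative. *)
Lemma lin_ge0_at0 (A B : R) : 0 <= B ->
  (forall t, 0 < t <= 1 -> 0 <= A + t * B) -> 0 <= A.
Proof.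
move=> B0 AB; rewrite leNgt; apply/negP => A0.
have C0 : 0 < 1 + B - A by lra.
have := AB (- A / (1 + B - A)); rewrite ler_pdivrMr // divr_gt0 ?oppr_gt0 //.
have -> : A + - A / (1 + B - A) * B = A * (1 - A) / (1 + B - A).
  by field; rewrite gt_eqF.
rewrite pmulr_lge0 ?invr_gt0 // => /(_ _) H.
have : 0 <= A * (1 - A) by apply: H; apply/andP; split=> //; lra.
nra.
Qed.

(** Compare [z] with the points of the segment from [z] to [y], use convexity of [h], divide by t
    and let t tend to 0. The linear term [a] makes this cover the PIAG step as well as the proximal
    map, where [a] is 0. *)
Lemma argmin_subdiff h a b s z : eproper h -> econvex h -> 0 <= s ->
  argmin (fun x => (h x + (dot a (x - b) + s * enorm (x - b) ^+ 2)%:E)%E) z ->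
  subdiff h z (- (a + (2 * s) *: (z - b))).
Proof.
move=> [hNy [x0 hx0]] hc s0 zmin y.
have hz : h z \is a fin_num.
  rewrite fin_numE hNy /=; apply/negP => /eqP hz.
  have := zmin x0; rewrite hz addye // leye_eq => /eqP.
  by case: (h x0) hx0 (hNy x0).
have [->|hy] := eqVneq (h y) +oo%E; first by rewrite leey.
have {hy} : h y \is a fin_num by rewrite fin_numE hNy.
move: hz => /fineK hz /fineK hy; move: hz hy.
move: (fine (h z)) (fine (h y)) => hz hy hzE hyE.
rewrite -hzE -hyE -EFinD lee_fin -subr_ge0.
apply: (@lin_ge0_at0 _ (s * enorm (y - z) ^+ 2)); first by rewrite mulr_ge0 ?sqr_ge0.
move=> t /andP[t0 t1].
have t01 : 0 <= t <= 1 by rewrite ltW.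
have := le_trans (zmin (t *: y + (1 - t) *: z)) (leeD2r _ (hc y z t t01)).
rewrite -hzE -hyE -!EFinM -!EFinD lee_fin.
have -> : t *: y + (1 - t) *: z - b = (z - b) + t *: (y - z).
  by apply/rowP => j; rewrite !mxE; ring.
move: (z - b) (y - z) => w u.
rewrite !enorm_sqr !(dotDr, dotDl, dotNl, dotZl, dotZr) (dotC u w) => H.
suff : 0 <= t * (hy - (hz - (dot a u + 2 * s * dot w u)) + t * (s * dot u u)).
  by rewrite pmulr_rge0.
lra.
Qed.

Lemma continuous_enormB_sqr (b : 'rV[R]_d) : continuous (fun x : 'rV[R]_d => enorm (x - b) ^+ 2).
Proof.
have H j : continuous (fun y : 'rV[R]_d => (y - b) 0 j).
  pose t (y : 'rV[R]_d) := y - b; pose c (M : 'rV[R]_d) := M 0 j.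
  suff : continuous (c \o t) by [].
  move=> x; apply: continuous_comp; last exact: coord_continuous.
  by apply: continuousB; [exact: cvg_id|exact: cst_continuous].
rewrite (_ : (fun x => _) = fun x => \sum_(j < d) (x - b) 0 j * (x - b) 0 j); last first.
  by apply/funext => y; rewrite enorm_sqr.
apply: (@continuous_big R^o) => [|j _ x]; first exact: add_continuous.
by apply: continuousM; exact: H.
Qed.

(** Guarantees that [prox] does not fall back on the default of [xget]. The subgradient at [x0]
    gives an affine minorant of [h], so the sublevel set of [x0] lies in a compact box; a cluster
    point of the nested sublevel sets is a minimizer by lower semicontinuity. *)
Lemma prox_argmin_nonempty h b s x0 v : eproper h -> lower_semicontinuous h ->
  subdiff h x0 v -> 0 < s ->
  exists z, argmin (fun x => (h x + (s * enorm (x - b) ^+ 2)%:E)%E) z.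
Proof.
move=> hp hl x0v s0; have hNy := hp.1.
pose q x := s * enorm (x - b) ^+ 2.
pose psi x := (h x + (q x)%:E)%E.
have psil : lower_semicontinuous psi.
  move=> x r rx.
  (* The margin [e] is kept in reserve to absorb the variation of the continuous term [q] near
     [x]. *)
  have [e e0 he] : exists2 e : R, 0 < e & ((r - q x + e)%:E < h x)%E.
    move: rx (hNy x); rewrite /psi; case: (h x) => [hx| |] //=.
      rewrite -EFinD lte_fin => rx _.
      by exists ((hx + q x - r) / 2); rewrite ?lte_fin; lra.
    by move=> _ _; exists 1; rewrite ?ltry.
  have [V Vx hV] := hl _ _ he.
  have qc : continuous q.
    rewrite (_ : q = (fun=> s) * (fun x => enorm (x - b) ^+ 2)) //.
    by move=> y; apply: continuousM; [exact: cst_continuous|exact: continuous_enormB_sqr].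
  have Wx : nbhs x [set y | `|q x - q y| < e].
    by have /cvgrPdist_lt/(_ _ e0) := qc x.
  exists (V `&` [set y | `|q x - q y| < e]); first exact: filterI.
  move=> y [/hV hy /= qy]; rewrite /psi -lteBlDr// -EFinB.
  apply: le_lt_trans hy; rewrite lee_fin.
  by move: qy; rewrite ltr_norml => /andP[]; lra.
pose B z := [set x | (psi x <= psi z)%E].
have hx0 : (h x0 < +oo)%E by rewrite ltey_eq (subdiff_fin hp x0v).
have fin z : (psi z <= psi x0)%E -> psi z \is a fin_num.
  rewrite fin_numE /psi => zx; apply/andP; split.
    by move: (hNy z); case: (h z).
  apply: contraTneq zx => ->; rewrite -ltNge.
  by move: hx0; case: (h x0) => // r _; rewrite -EFinD ltry.
pose D := [set z | (psi z <= psi x0)%E].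
have FF : Filter (filter_from D B).
  apply: filter_from_filter; first by exists x0; rewrite /D /=.
  move=> y z Dy Dz; have [yz|/ltW zy] := leP (psi y) (psi z).
    by exists y => // x /= xy; split; rewrite /B /= ?(le_trans xy).
  by exists z => // x /= xz; split; rewrite /B /= ?(le_trans xz).
have FP : ProperFilter (filter_from D B).
  by apply: filter_from_proper => y Dy; exists y; rewrite /B /=.
(* With e = |x - b|, the sublevel condition and the affine minorant give s e^2 <= s r^2 + |v| (e +
   r). Completing the square turns this into (e - V)^2 <= (V + r)^2, hence e <= 2 V + r. *)
pose V := enorm v / (2 * s); pose r := enorm (x0 - b).
pose M := 2 * V + r.
have V0 : 0 <= V by rewrite divr_ge0 ?enorm_ge0 // ltW ?mulr_gt0.
have r0 : 0 <= r by exact: enorm_ge0.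
have Kc : compact [set x : 'rV[R]_d | forall j, [set` `[b 0 j - M, b 0 j + M]] (x 0 j)].
  by apply: (@rV_compact R d (fun j => [set` `[b 0 j - M, b 0 j + M]])) => j; exact: segment_compact.
have DK : D `<=` [set x : 'rV[R]_d | forall j, [set` `[b 0 j - M, b 0 j + M]] (x 0 j)].
  move=> x /= Dx j; rewrite in_itv /= -ler_distlC.
  suff xM : enorm (x - b) <= M.
    by rewrite distrC (le_trans _ xM) // (le_trans _ (enorm_coord _ j)) // !mxE.
  have hx : (h x < +oo)%E.
    by have := fin _ Dx; rewrite /psi; case: (h x) => // r' _; rewrite ltry.
  have := subdiff_fine hp x0v hx.
  have := Dx; rewrite /D /= /psi.
  have /fineK <- : h x \is a fin_num by rewrite fin_numE hNy -ltey.
  have /fineK <- : h x0 \is a fin_num by rewrite fin_numE hNy -ltey.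
  rewrite -!EFinD lee_fin /= => H1 H2.
  have H3 : - (enorm v * (enorm (x - b) + r)) <= dot v (x - x0).
    have /ler_normlP[+ _] := dot_norm_le v (x - x0); rewrite lerNl; apply: le_trans.
    rewrite lerN2 ler_wpM2l ?enorm_ge0 // /r (enormBC x0).
    exact: ler_enormB_trans.
  have vV : enorm v = 2 * s * V by rewrite mulrC divfK // gt_eqF // mulr_gt0.
  have H4 : s * (enorm (x - b) - V) ^+ 2 <= s * (V + r) ^+ 2.
    move: H1 H2 H3; rewrite /q vV -/r; move: (enorm _) => e.
    by rewrite !expr2; nra.
  move: H4; rewrite ler_pM2l // => H4.
  have : enorm (x - b) - V <= V + r.
    rewrite leNgt; apply/negP => H5; move: H4; rewrite leNgt => /negP; apply.
    by rewrite ltr_pXn2r // nnegrE; lra.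
  by rewrite /M; lra.
have [z [_ zcl]] : [set x : 'rV[R]_d | forall j, [set` `[b 0 j - M, b 0 j + M]] (x 0 j)] `&`
    cluster (filter_from D B) !=set0.
  by apply: Kc; exists x0; [rewrite /D /=|exact: DK].
(* Otherwise [psi] exceeds [psi y] on a whole neighbourhood of [z], which then misses the sublevel
   set [B y]. *)
have zD y : D y -> (psi z <= psi y)%E.
  move=> Dy; rewrite leNgt; apply/negP.
  rewrite -(fineK (fin _ Dy)) => /psil[W Wz hW].
  have [|x [+ /hW]] := zcl (B y) W _ Wz; first by exists y.
  by rewrite /B /= (fineK (fin _ Dy)) => /le_lt_trans /[apply]; rewrite ltxx.
exists z => y; have [/zD//|/ltW xy] := leP (psi y) (psi x0).
by rewrite (le_trans _ xy) // zD /D /=.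
Qed.

Lemma prox_subdiff h c y x0 v : eproper h -> lower_semicontinuous h ->
  econvex h -> subdiff h x0 v -> 0 < c ->
  let z := prox (fun x => c%:E * h x)%E y in subdiff h z (c^-1 *: (y - z)).
Proof.
move=> hp hl hc x0v c0 z.
have c20 : 0 < (2 * c)^-1 by rewrite invr_gt0 mulr_gt0.
(* Factoring out [c] brings the proximal problem to the form of [argmin_subdiff], with weight
   [(2 * c)^-1]. *)
have E x : (c%:E * h x + (2^-1 * enorm (x - y) ^+ 2)%:E =
    c%:E * (h x + ((2 * c)^-1 * enorm (x - y) ^+ 2)%:E))%E.
  rewrite muleDr // ?fin_num_adde_defl // -EFinM; congr (_ + _%:E)%E.
  by field; rewrite gt_eqF.
have : argmin (fun x => (h x + ((2 * c)^-1 * enorm (x - y) ^+ 2)%:E)%E) z.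
  have [z0 z0min] := prox_argmin_nonempty y hp hl x0v c20.
  have : argmin (fun x => (c%:E * h x + (2^-1 * enorm (x - y) ^+ 2)%:E)%E) z.
    rewrite /z /prox; apply: xgetPex.
    by exists z0 => x; rewrite !E lee_pmul2l.
  by move=> zmin x; have := zmin x; rewrite !E lee_pmul2l.
move=> zmin.
have := @argmin_subdiff h 0 y (2 * c)^-1 z hp hc (ltW c20).
rewrite add0r -scalerN opprB.
have -> : 2 * (2 * c)^-1 = c^-1 by field; rewrite gt_eqF.
by apply=> x; rewrite !dot0l !add0r.
Qed.

(** Monotonicity of the subdifferential: adding the subgradient inequalities at [x] and at the
    proximal point [z] gives L |z - x|^2 <= - <grad p x + v, z - x>, and Cauchy-Schwarz
    concludes. *)
Lemma prox_residual_le (L : R) (p : 'rV[R]_d -> R) h x v : 0 < L ->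
  eproper h -> lower_semicontinuous h -> econvex h -> subdiff h x v ->
  prox_residual L p h x <= L^-1 * enorm (grad p x + v).
Proof.
move=> L0 hp hl hc xv; rewrite /prox_residual.
set y := x - _; set z := prox _ y.
have iL0 : 0 < L^-1 by rewrite invr_gt0.
have zv : subdiff h z (L *: (y - z)).
  by rewrite -(invrK L); exact: prox_subdiff xv iL0.
have fin u w : subdiff h u w -> (h u < +oo)%E.
  by move=> /(subdiff_fin hp); rewrite ltey_eq => ->.
have := subdiff_fine hp zv (fin _ _ xv).
have := subdiff_fine hp xv (fin _ _ zv).
have -> : L *: (y - z) = - grad p x - L *: (z - x).
  by rewrite /y; apply/rowP => j; rewrite !mxE; field; rewrite gt_eqF.
have -> : x - z = - (z - x) by rewrite opprB.
rewrite dotNr dotDl !dotNl dotZl -enorm_sqr => H1 H2.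
have H3 : L * enorm (z - x) ^+ 2 <= enorm (grad p x + v) * enorm (z - x).
  have := dot_norm_le (grad p x + v) (z - x).
  by rewrite dotDl ler_norml => /andP[]; lra.
rewrite ler_pdivlMl //.
have [->|zx] := eqVneq (enorm (z - x)) 0; first by rewrite mulr0 enorm_ge0.
have zx0 : 0 < enorm (z - x) by rewrite lt_neqAle eq_sym zx enorm_ge0.
by move: H3; rewrite expr2 mulrA ler_pM2r.
Qed.

End Prox.

(** * Real sequences: sufficient decrease and geometric rates *)

Section Sequences.
Context {R : realType}.
Implicit Types (V W delta e : nat -> R) (a b q : R).

(** From [K] on, [V] is monotone and bounded below, hence convergent; its consecutive differences
    dominate [a * delta k.+1 ^+ 2]. *)
Lemma sufficient_decrease_vanish V delta a b (K : nat) : 0 < a ->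
  (forall k, (K <= k)%N -> V k.+1 <= V k - a * delta k.+1 ^+ 2) ->
  (forall k, (K <= k)%N -> b <= V k) ->
  forall r, 0 < r -> exists n, forall k, (n <= k)%N -> `|delta k| < r.
Proof.
move=> a0 dec lb r r0.
have : cvgn (fun k => V (K + k)%N).
  apply: nonincreasing_is_cvgn; last first.
    by exists b => _ [k _ <-]; rewrite lb ?leq_addr.
  apply/nonincreasing_seqP => k; rewrite addnS (le_trans (dec _ _)) ?leq_addr //.
  by rewrite gerBl mulr_ge0 ?sqr_ge0 // ltW.
move=> /cvg_ex[/= l Vl].
have e0 : 0 < a * r ^+ 2 / 2 by rewrite divr_gt0 ?mulr_gt0 ?exprn_gt0.
have /cvgrPdist_lt/(_ _ e0)[n _ Hn] := Vl.
exists (K + n).+1 => -[//|k]; rewrite ltnS => nk.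
have Kk : (K <= k)%N by rewrite (leq_trans _ nk) ?leq_addr.
have nk' : (n <= k - K)%N by rewrite leq_subRL.
have := Hn _ nk'; have := Hn (k - K).+1 (leqW nk').
rewrite /= addnS subnKC // => H1 H2.
have H3 : a * delta k.+1 ^+ 2 < a * r ^+ 2.
  have := dec _ Kk; move: H1 H2; rewrite !ltr_norml => /andP[? ?] /andP[? ?].
  by lra.
move: H3; rewrite ltr_pM2l // -[delta _ ^+ 2]real_normK ?num_real //.
by rewrite ltr_pXn2r // nnegrE // ltW.
Qed.

Lemma window_vanish delta (t : nat) :
  (forall r, 0 < r -> exists n, forall k, (n <= k)%N -> `|delta k| < r) ->
  forall r, 0 < r -> exists n, forall k, (n <= k)%N ->
    \sum_(s < t) delta (k - s)%N < r.
Proof.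
move=> d0 r r0.
(* Dividing by t + 1 instead of t keeps the final inequality strict and allows t = 0. *)
have [|n Hn] := d0 (r / t.+1%:R); first by rewrite divr_gt0.
exists (n + t)%N => k nk.
have H (s : 'I_t) : delta (k - s)%N <= r / t.+1%:R.
  rewrite (le_trans (ler_norm _)) // ltW // Hn // leq_subRL.
    by rewrite addnC (leq_trans _ nk) // leq_add2l ltnW.
  by rewrite (leq_trans _ nk) // ltnW // (leq_trans (ltn_ord s)) // leq_addl.
apply: (@le_lt_trans _ _ (\sum_(s < t) r / t.+1%:R)); first exact: ler_sum.
rewrite sumr_const card_ord -[_ *+ t]mulr_natr -mulrA gtr_pMr // mulrC.
by rewrite ltr_pdivrMr // mul1r ltr_nat.
Qed.

(** Cauchy-Schwarz against the all-ones vector. *)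
Lemma sqr_sum_le (t : nat) (e : 'I_t -> R) :
  (\sum_s e s) ^+ 2 <= t%:R * \sum_s e s ^+ 2.
Proof.
pose u : 'rV[R]_t := const_mx 1; pose v : 'rV[R]_t := \row_s e s.
have -> : \sum_s e s = dot u v.
  by apply: eq_bigr => s _; rewrite !mxE mul1r.
have -> : t%:R = dot u u.
  rewrite /dot; under eq_bigr do rewrite mxE mulr1.
  by rewrite sumr_const card_ord.
have -> : \sum_s e s ^+ 2 = dot v v.
  by apply: eq_bigr => s _; rewrite !mxE expr2.
rewrite -!enorm_sqr -exprMn -real_normK ?num_real //.
by rewrite ler_pXn2r ?nnegrE ?mulr_ge0 ?enorm_ge0 // dot_norm_le.
Qed.

Lemma bernoulli_le (x : R) (n : nat) : 0 <= x <= 1 -> 1 - n%:R * x <= (1 - x) ^+ n.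
Proof.
move=> /andP[x0 x1]; elim: n => [|n IH]; first by rewrite mul0r subr0 expr0.
rewrite exprS -natr1; have : 0 <= (n%:R : R) by [].
have : (1 - x) * (1 - n%:R * x) <= (1 - x) * (1 - x) ^+ n.
  by rewrite ler_wpM2l // subr_ge0.
by move: (_ ^+ n) => y; nra.
Qed.

(** A contraction over t + 1 steps is spread into a one-step rate [q] with rho <= q^(t + 1).
    Monotonicity handles the first t + 1 indices, strong induction the others. *)
Lemma delayed_contraction W (K t : nat) (rho : R) : 0 <= rho < 1 ->
  (forall k, (K <= k)%N -> 0 <= W k) ->
  (forall k, (K <= k)%N -> W k.+1 <= W k) ->
  (forall k, (K <= k)%N -> W (k + t.+1)%N <= rho * W k) ->
  exists A q, [/\ 0 <= A, 0 < q < 1 & forall k, (K <= k)%N -> W k <= A * q ^+ k].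
Proof.
move=> /andP[rho0 rho1] W0 Wd Wc.
(* Bernoulli only asks for (t + 1) x <= 1 - rho; the denominator t + 2 also keeps [q] positive when
   rho = 0 and t = 0. *)
pose x := (1 - rho) / t.+2%:R; pose q := 1 - x.
have t0 : 0 < (t.+2%:R : R) by [].
have x0 : 0 < x by rewrite divr_gt0 // subr_gt0.
have x1 : x < 1.
  rewrite ltr_pdivrMr // mul1r (@le_lt_trans _ _ 1) ?ltr1n //.
  by rewrite gerBl.
have q0 : 0 < q by rewrite subr_gt0.
have q1 : q < 1 by rewrite gtrBl.
have rq : rho <= q ^+ t.+1.
  apply: le_trans (bernoulli_le _ _); last by rewrite !ltW.
  suff : t.+1%:R * x <= 1 - rho by lra.
  rewrite mulrCA ler_piMr ?subr_ge0 ?ltW // ltr_pdivrMr // mul1r.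
  by rewrite ltr_nat.
(* Chosen so that A q^k >= W K for every k <= K + t. *)
pose A := W K / q ^+ (K + t).
have Q n : 0 < q ^+ n by rewrite exprn_gt0.
have WK k : (K <= k)%N -> W k <= W K.
  move=> /subnKC <-; elim: (k - K)%N => [|n IH]; first by rewrite addn0.
  by rewrite addnS (le_trans (Wd _ _)) // leq_addr.
exists A, q; split; [by rewrite divr_ge0 ?W0 // ltW|by rewrite q0|].
elim/ltn_ind => k IH Kk; have [kt|kt] := leqP k (K + t).
  apply: le_trans (WK _ Kk) _; rewrite /A mulrAC ler_pdivlMr //.
  rewrite ler_wpM2l ?W0 // ler_wiXn2l // ltW //.
have tk : (t.+1 <= k)%N by rewrite (leq_trans _ kt) // ltnS leq_addl.
have Kk' : (K <= k - t.+1)%N by rewrite leq_subRL // addnC addnS.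
have := Wc _ Kk'; rewrite subnK // => /le_trans; apply.
apply: (@le_trans _ _ (q ^+ t.+1 * (A * q ^+ (k - t.+1)))).
  apply: ler_pM => //; first exact: W0.
  by apply: IH => //; rewrite ltn_subrL (leq_trans _ tk).
by rewrite mulrCA -exprD subnKC.
Qed.

Lemma sufficient_decrease_linear W delta a C (K t : nat) : 0 < a -> 0 <= C ->
  (forall k, (K <= k)%N -> 0 <= W k) ->
  (forall k, (K <= k)%N -> W k.+1 <= W k - a * delta k.+1 ^+ 2) ->
  (forall k, (K <= k)%N -> W k.+1 <= C * \sum_(s < t.+1) delta (k.+1 - s)%N ^+ 2) ->
  exists A q, [/\ 0 <= A, 0 < q < 1 & forall k, `|delta k| <= A * q ^+ k].
Proof.
move=> a0 C0 W0 dec ub.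
have tel k n : (K <= k)%N ->
    W (k + n)%N + a * \sum_(s < n) delta (k + n - s)%N ^+ 2 <= W k.
  move=> Kk; elim: n => [|n IH]; first by rewrite big_ord0 mulr0 addr0 addn0.
  rewrite big_ord_recl /= subn0 addnS.
  under eq_bigr do rewrite /bump /= add1n subSS.
  have := dec _ (leq_trans Kk (leq_addr n k)).
  by move: IH; lra.
have aC : 0 < a + C by rewrite ltr_pwDl.
(* If Q is the sum of the last t + 1 squares, then W (k + t + 1) <= C Q and a Q <= W k - W (k + t +
   1). Eliminating Q gives the ratio C / (a + C). *)
have [||k Kk|k Kk|A [q [A0 /andP[q0 q1] WA]]] := @delayed_contraction W K t (C / (a + C)).
- apply/andP; split; first by rewrite divr_ge0 // ltW.
  by rewrite ltr_pdivrMr // mul1r ltrDr.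
- exact: W0.
- by rewrite (le_trans (dec _ Kk)) // gerBl mulr_ge0 ?sqr_ge0 // ltW.
- have := tel _ t.+1 Kk; have := ub _ (leq_trans Kk (leq_addr t k)).
  rewrite -addnS; set S := \sum_(s < _) _ => H1 H2.
  rewrite mulrAC ler_pdivlMr // mulrDr.
  have S0 : C * (a * S) <= C * (W k - W (k + t.+1)%N) by rewrite ler_wpM2l //; lra.
  have : a * W (k + t.+1)%N <= a * (C * S) by rewrite ler_wpM2l // ltW.
  by move: S0; rewrite !mulrBr mulrCA; lra.
(* Since a delta_(k+1)^2 <= W k, the increments inherit the square root of the rate of [W]. *)
pose r := Num.sqrt q.
have r0 : 0 < r by rewrite sqrtr_gt0.
have r1 : r < 1 by rewrite -sqrtr1 ltr_sqrt.
have rq : r ^+ 2 = q by rewrite sqr_sqrtr // ltW.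
pose B := Num.sqrt (A / a) / r.
have B0 : 0 <= B by rewrite divr_ge0 ?sqrtr_ge0 // ltW.
have dB k : (K < k)%N -> `|delta k| <= B * r ^+ k.
  case: k => // k; rewrite ltnS => Kk.
  rewrite /B exprS mulrA divfK ?gt_eqF //.
  rewrite -(@ler_pXn2r _ 2) ?nnegrE ?mulr_ge0 ?sqrtr_ge0 ?exprn_ge0 ?(ltW r0) //.
  rewrite real_normK ?num_real // exprMn sqr_sqrtr ?divr_ge0 ?(ltW a0) // exprAC rq.
  rewrite mulrAC ler_pdivlMr // mulrC (le_trans _ (WA _ Kk)) //.
  by have := dec _ Kk; have := W0 _ (leqW Kk); lra.
(* Enlarging the constant by [D] covers the indices up to [K]. *)
pose D := \sum_(j < K.+1) `|delta j| / r ^+ j.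
have Dj (j : 'I_K.+1) : 0 <= `|delta j| / r ^+ j by rewrite divr_ge0 // exprn_ge0 // ltW.
have D0 : 0 <= D by apply: sumr_ge0 => j _.
exists (B + D), r; split; rewrite ?addr_ge0 ?r0 // => k.
have rk : 0 < r ^+ k by rewrite exprn_gt0.
have [Kk|kK] := ltnP K k.
  by rewrite (le_trans (dB _ Kk)) // ler_wpM2r ?(ltW rk) // lerDl.
rewrite -ler_pdivrMr // /D (bigD1 (Ordinal (kK : (k < K.+1)%N))) //=.
by rewrite addrCA lerDl addr_ge0 // sumr_ge0.
Qed.

Lemma geometric_increments_cvg (u : nat -> R) A q : 0 <= A -> 0 < q < 1 ->
  (forall k, `|u k.+1 - u k| <= A * q ^+ k) ->
  exists l, forall k, `|u k - l| <= A / (1 - q) * q ^+ k.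
Proof.
move=> A0 /andP[q0 q1] uA.
have q'0 : 0 < 1 - q by rewrite subr_gt0.
have du k n : `|u (k + n)%N - u k| <= A / (1 - q) * (q ^+ k - q ^+ (k + n)).
  elim: n => [|n IH]; first by rewrite addn0 !subrr normr0 mulr0.
  have := uA (k + n)%N; rewrite -addnS => H.
  have -> : u (k + n.+1)%N - u k = (u (k + n.+1)%N - u (k + n)%N) + (u (k + n)%N - u k).
    by rewrite addrA subrK.
  apply: le_trans (ler_normD _ _) _; apply: le_trans (lerD H IH) _.
  have -> : A * q ^+ (k + n) = A / (1 - q) * (q ^+ (k + n) - q ^+ (k + n.+1)).
    by rewrite addnS exprS; field; rewrite gt_eqF.
  by rewrite -mulrDr le_eqVlt; apply/orP; left; apply/eqP; ring.
have B0 : 0 <= A / (1 - q) by rewrite divr_ge0 // ltW.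
(* Every [v k] lies below every [w n], so the supremum of [v] lies between [v k] and [w k] for each
   k; it is the required limit. *)
pose v k := u k - A / (1 - q) * q ^+ k; pose w k := u k + A / (1 - q) * q ^+ k.
have bnd k n : v k <= w n.
  have E m j : u (m + j)%N - u m <= A / (1 - q) * (q ^+ m - q ^+ (m + j)) /\
      - (u (m + j)%N - u m) <= A / (1 - q) * (q ^+ m - q ^+ (m + j)).
    by have := du m j; rewrite ler_norml => /andP[? ?]; split=> //; rewrite lerNl.
  have P m : 0 <= A / (1 - q) * q ^+ m by rewrite mulr_ge0 // exprn_ge0 // ltW.
  rewrite /v /w; have [/subnKC <-|/ltnW/subnKC <-] := leqP k n.
    by have [_] := E k (n - k)%N; have := P (k + (n - k))%N; rewrite mulrBr; lra.
  by have [+ _] := E n (k - n)%N; have := P (n + (k - n))%N; rewrite mulrBr; lra.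
have hs : has_sup (range v) by split; [exists (v 0%N), 0%N|exists (w 0%N) => _ [k _ <-]].
exists (sup (range v)) => k; rewrite distrC ler_distl; apply/andP; split.
  by apply: ub_le_sup; [exact: hs.2|exists k].
by apply: ge_sup; [exact: hs.1|move=> _ [n _ <-]; exact: bnd].
Qed.

End Sequences.

(** * Summability and R-linear convergence from geometric increments *)

Section Rlinear.
Context {R : realType} {d : nat}.
Variables (xs : nat -> 'rV[R]_d) (A q : R).
Hypotheses (A0 : 0 <= A) (q01 : 0 < q < 1).
Hypothesis xsA : forall k, enorm (xs k.+1 - xs k) <= A * q ^+ k.

Lemma geometric_enorm_summable : (\sum_(0 <= i <oo) (enorm (xs i.+1 - xs i))%:E < +oo)%E.
Proof.
case/andP: q01 => q0 q1.
apply: (@le_lt_trans _ _ (A / (1 - q))%:E); last by rewrite ltry.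
apply: lime_le.
  by apply: is_cvg_nneseries => n _ _; rewrite lee_fin enorm_ge0.
apply: nearW => n; rewrite sumEFin lee_fin.
have q'0 : 0 < 1 - q by rewrite subr_gt0.
suff : \sum_(0 <= i < n) enorm (xs i.+1 - xs i) <= A / (1 - q) * (1 - q ^+ n).
  move=> /le_trans; apply; rewrite ler_piMr ?divr_ge0 ?(ltW q'0) //.
  by rewrite gerBl exprn_ge0 // ltW.
elim: n => [|n IH]; first by rewrite big_geq // expr0 subrr mulr0.
rewrite big_nat_recr //= (le_trans (lerD IH (xsA n))) //.
rewrite le_eqVlt; apply/orP; left; apply/eqP; rewrite exprS; field.
by rewrite gt_eqF.
Qed.

Lemma geometric_R_linearly_convergent : R_linearly_convergent xs.
Proof.
case/andP: (q01) => q0 q1.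
have H (j : 'I_d) : exists l, forall k, `|xs k 0 j - l| <= A / (1 - q) * q ^+ k.
  apply: (geometric_increments_cvg A0 q01) => k; apply: le_trans (xsA k).
  by rewrite (le_trans _ (enorm_coord _ j)) // !mxE.
have [xstar xstarP] := choice H.
pose x := (\row_j xstar j : 'rV[R]_d); exists x.
pose B := A / (1 - q) *+ d.
have xB k : enorm (xs k - x) <= B * q ^+ k.
  apply: le_trans (enorm_le_sum _) _.
  apply: (@le_trans _ _ (\sum_(j < d) A / (1 - q) * q ^+ k)).
    by apply: ler_sum => j _; rewrite !mxE; exact: xstarP.
  by rewrite sumr_const card_ord mulrnAl.
(* The gap between [q] and [r] absorbs the constant: B q^k <= r^k eventually, so the k-th roots are
   at most [r]. *)
have [r /andP[qr r1]] : exists r, q < r < 1 by exists ((q + 1) / 2); lra.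
have r0 : 0 < r by exact: lt_trans qr.
have qr1 : `|q / r| < 1.
  by rewrite ger0_norm ?divr_ge0 ?ltW // ltr_pdivrMr // mul1r.
have /cvgrPdist_lt/(_ _ ltr01)[n _ Hn] := cvg_geometric B qr1.
have xr k : (n <= k)%N -> enorm (xs k - x) <= r ^+ k.
  move=> /Hn /=; rewrite sub0r normrN => /ltW/(le_trans (ler_norm _)).
  rewrite expr_div_n mulrA ler_pdivrMr ?exprn_gt0 // mul1r.
  exact: le_trans.
apply: (@le_lt_trans _ _ r%:E); last by rewrite lte_fin.
(* The upper limit is an infimum of suprema over tails. The tail k > n also excludes k = 0, where
   the exponent 1/k is degenerate. *)
apply: ge_ereal_inf; exists (ereal_sup ((fun k => (enorm (xs k - x) `^ k%:R^-1)%:E) @` [set k | (n < k)%N])).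
  by exists [set k | (n < k)%N] => //; exists n.+1.
apply: ge_ereal_sup => _ [k /= nk <-]; rewrite lee_fin.
have k0 : (k%:R : R) != 0 by rewrite pnatr_eq0 -lt0n (leq_trans _ nk).
rewrite (_ : r = (r ^+ k) `^ k%:R^-1).
  by rewrite ge0_ler_powR ?nnegrE ?invr_ge0 ?enorm_ge0 ?exprn_ge0 ?(ltW r0) // xr // ltnW.
by rewrite -powR_mulrn ?(ltW r0) // -powRrM divff // powRr1 // ltW.
Qed.

End Rlinear.

(** * Lipschitz constants of the gradients *)

Section Smoothness.
Context {R : realType} {d : nat}.
Implicit Types (p : 'rV[R]_d -> R) (M m : R).

(** The triangle inequality on the difference of the two gradients; the size of the constant affects
    only the admissible stepsizes. *)
Lemma smooth_dc_smooth M m p : smooth_dc M m p -> is_smooth (M + m) p.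
Proof.
move=> [p1 [p2 [_ [d1 s1] _ [d2 s2] pE]]].
have {pE} -> : p = (fun x => p1 x - p2 x) by apply/funext.
split=> [x|x y]; first exact: differentiableB.
rewrite !gradB // mulrDl.
have -> (V : zmodType) (a b a' b' : V) : a - b - (a' - b') = (a - a') + - (b - b').
  by rewrite !opprB -!addrA [- b + _]addrCA [- a' + _]addrCA [- b - a']addrC.
by rewrite (le_trans (ler_enormD _ _)) // enormN lerD.
Qed.

Lemma smooth_sum (N : nat) (f : 'I_N -> 'rV[R]_d -> R) (M : 'I_N -> R) :
  (forall i, is_smooth (M i) (f i)) ->
  is_smooth (\sum_i M i) (fun x => \sum_(i < N) f i x).
Proof.
move=> fM; have fd i x : differentiable (f i) x by have [] := fM i.
split=> [x|x y]; first exact: differentiable_sumf.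
rewrite !grad_sum // -sumrB mulr_suml (le_trans (ler_enorm_sum _ _)) //.
by apply: ler_sum => i _; have [_] := fM i; exact.
Qed.

End Smoothness.

(** * Objective values near stationary points *)

Section CompositeObjective.
Context {R : realType} {d : nat}.
Implicit Types (p : 'rV[R]_d -> R) (h : 'rV[R]_d -> \bar R) (x y v : 'rV[R]_d).

Lemma objective_fine p h x : h x \is a fin_num ->
  objective p h x = (p x + fine (h x))%:E.
Proof. by move=> /fineK hx; rewrite /objective -{1}hx EFinD. Qed.

(** The subgradient inequality for [h] and the Taylor bound for [p], both taken at [x]. It serves
    twice: with [x] an iterate for the upper bound on the gap, and with [x] stationary for the lower
    bound. *)
Lemma fine_objective_le_near (M : R) p h x y v : 0 <= M -> is_smooth M p ->
  eproper h -> subdiff h x v -> (h y < +oo)%E ->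
  fine (objective p h x) - fine (objective p h y) <=
    enorm (grad p x + v) * enorm (x - y) + M * enorm (x - y) ^+ 2.
Proof.
move=> M0 pM hp xv hy.
have hyf : h y \is a fin_num by rewrite fin_numE hp.1 -ltey.
rewrite !objective_fine ?(subdiff_fin hp xv) //=.
have H1 := subdiff_fine hp xv hy.
have := smooth_taylor x y M0 pM; rewrite ler_norml => /andP[H2 _].
have := dot_norm_le (grad p x + v) (x - y); rewrite ler_norml => /andP[_ H3].
move: H1 H2 H3; rewrite (enormBC y x) -(opprB x y) !dotNr dotDl.
lra.
Qed.

Lemma stationary_fin p h y : eproper h -> stationary p h y -> h y \is a fin_num.
Proof. by move=> hp [v /(subdiff_fin hp)]. Qed.

(** At a stationary point the subgradient can be taken equal to [- grad p y], which removes the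
    first-order term. *)
Lemma stationary_fine_objective_le (M : R) p h x y : 0 <= M -> is_smooth M p ->
  eproper h -> stationary p h y -> (h x < +oo)%E ->
  fine (objective p h y) - M * enorm (x - y) ^+ 2 <= fine (objective p h x).
Proof.
move=> M0 pM hp [v yv gv] hx.
have := fine_objective_le_near M0 pM hp yv hx.
by rewrite gv enorm0 mul0r (enormBC y); lra.
Qed.

Lemma edist_lt x (C : set 'rV[R]_d) (r : R) : (Defs.edist x C < r%:E)%E ->
  exists2 y, C y & enorm (x - y) < r.
Proof. by move=> /ereal_inf_lt[_ [y Cy <-]]; rewrite lte_fin; exists y. Qed.

End CompositeObjective.

(** * PIAG iterates and their Lyapunov function *)

Section Iterates.
Context {R : realType} {d N : nat}.
Variables (f : 'I_N -> 'rV[R]_d -> R) (h : 'rV[R]_d -> \bar R) (M : 'I_N -> R).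
Variables (tau : nat) (alpha : R) (delay : nat -> 'I_N -> nat) (xs : nat -> 'rV[R]_d).
Hypotheses (M_ge0 : forall i, 0 <= M i) (f_smooth : forall i, is_smooth (M i) (f i)).
Hypotheses (h_proper : eproper h) (h_lsc : lower_semicontinuous h) (h_convex : econvex h).
Hypothesis alpha_gt0 : 0 < alpha.
Hypothesis delay_le : forall k i, (1 <= k)%N -> (delay k i <= tau)%N.
Hypothesis xs_piag : piag f h alpha delay xs.

Let p x := \sum_(i < N) f i x.
Let Mp := \sum_i M i.
Let g k := \sum_(i < N) grad (f i) (xs (k - delay k i)%N).
(* [delta 0 = 0], so the windows [delta (k - s)] below are correct for [k < s]. *)
Let delta k := enorm (xs k - xs k.-1).
(** The subgradient of [h] at [xs k.+1] supplied by the optimality condition of step k. *)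
Let v k := - (g k + alpha^-1 *: (xs k.+1 - xs k)).
Let Fx k := fine (objective p h (xs k)).

Let Mp_ge0 : 0 <= Mp. Proof. exact: sumr_ge0. Qed.
Let delta_ge0 k : 0 <= delta k. Proof. exact: enorm_ge0. Qed.
Let p_smooth : is_smooth Mp p. Proof. exact: smooth_sum. Qed.

Lemma piag_subdiff k : subdiff h (xs k.+1) (v k).
Proof.
have s0 : 0 <= (2 * alpha)^-1 by rewrite invr_ge0 mulr_ge0 // ltW.
have s2 : 2 * (2 * alpha)^-1 = alpha^-1 by field; rewrite gt_eqF.
by have := argmin_subdiff h_proper h_convex s0 (xs_piag k); rewrite s2.
Qed.

(** The starting point may lie outside the domain of [h], so objective values are compared only from
    index 1 on. *)
Lemma piag_fin k : (0 < k)%N -> h (xs k) \is a fin_num.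
Proof. by case: k => // k _; exact: subdiff_fin (piag_subdiff k). Qed.

Let h_lt k : (0 < k)%N -> (h (xs k) < +oo)%E.
Proof. by move=> /piag_fin; rewrite ltey_eq => ->. Qed.

Lemma path_length k n : enorm (xs k - xs (k - n)%N) <= \sum_(s < n) delta (k - s)%N.
Proof.
elim: n => [|n IH]; first by rewrite subn0 subrr enorm0 big_ord0.
rewrite big_ord_recr /= (le_trans (ler_enormB_trans (xs (k - n)%N) _ _)) //.
by rewrite lerD // /delta -subnS.
Qed.

(** The point [y] is left free: [descent] takes [xs k], the residual bound takes [xs k.+1]. *)
Lemma aggregated_gradient_error k y :
  enorm (grad p y - g k) <= Mp * (enorm (y - xs k) + \sum_(s < tau) delta (k - s)%N).
Proof.
have fd i x : differentiable (f i) x by have [] := f_smooth i.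
rewrite grad_sum // /g -sumrB mulr_suml (le_trans (ler_enorm_sum _ _)) //.
apply: ler_sum => i _; apply: le_trans ((f_smooth i).2 _ _) _.
rewrite ler_wpM2l // (le_trans (ler_enormB_trans (xs k) _ _)) // lerD2l.
(* Delays are bounded only for k >= 1; at k = 0 truncation gives [xs 0] whatever the delay. *)
case: (posnP k) => [->|k0].
  by rewrite sub0n subrr enorm0 sumr_ge0.
rewrite (le_trans (path_length _ _)) //.
rewrite (big_ord_widen _ (fun s => delta (k - s)%N) (delay_le i k0)).
by rewrite big_mkcond; apply: ler_sum => s _; case: ifP.
Qed.

(** Adds the subgradient inequality at [xs k.+1] tested at [xs k], the Taylor bound at [xs k], and
    Cauchy-Schwarz for the delayed-gradient error. *)
Lemma descent k : (0 < k)%N ->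
  Fx k.+1 <= Fx k - (alpha^-1 - Mp) * delta k.+1 ^+ 2
    + Mp * (delta k.+1 * \sum_(s < tau) delta (k - s)%N).
Proof.
move=> k0; rewrite /Fx !objective_fine ?piag_fin //=.
have H1 := subdiff_fine h_proper (piag_subdiff k) (h_lt k0).
have := smooth_taylor (xs k) (xs k.+1) Mp_ge0 p_smooth.
rewrite ler_norml => /andP[_ H2].
have := dot_norm_le (grad p (xs k) - g k) (xs k.+1 - xs k).
rewrite ler_norml => /andP[_ H3].
have := aggregated_gradient_error k (xs k); rewrite subrr enorm0 add0r => H4.
have := ler_wpM2r (delta_ge0 k.+1) H4.
move: H1; rewrite /v -(opprB (xs k.+1)) dotNr dotNl dotDl dotZl -enorm_sqr.
move: H2 H3; rewrite dotBl /delta /=; move: (enorm (xs k.+1 - xs k)) => e.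
lra.
Qed.

(** A squared increment enters with weight [tau] and loses one unit per step, so each step releases
    the plain sum of the squares in the window. *)
Let lyap k := \sum_(s < tau) (tau - s)%:R * delta (k - s)%N ^+ 2.
Let V k := Fx k + Mp / 2 * lyap k.

Lemma lyapS k :
  lyap k.+1 = tau%:R * delta k.+1 ^+ 2 + lyap k - \sum_(s < tau) delta (k - s)%N ^+ 2.
Proof.
(* The added term s = tau has weight 0, and splitting off s = 0 instead gives the shifted sum. *)
pose a := \sum_(s < tau.+1) (tau - s)%:R * delta (k.+1 - s)%N ^+ 2.
have <- : a = lyap k.+1 by rewrite /a big_ord_recr /= subnn mul0r addr0.
rewrite /a big_ord_recl /= !subn0 -addrA /lyap -sumrB; congr (_ + _).
apply: eq_bigr => s _; rewrite /bump /= add1n subSS subnS.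
have ts : (0 < tau - s)%N by rewrite subn_gt0.
by rewrite -[in RHS](prednK ts) -natr1 mulrDl mul1r addrK.
Qed.

Lemma lyap_ge0 k : 0 <= lyap k.
Proof. by apply: sumr_ge0 => s _; rewrite mulr_ge0 ?sqr_ge0. Qed.

(** Young's inequality splits the cross term of [descent]; [lyapS] cancels the old squares, leaving
    the coefficient 1/alpha - Mp (tau + 1) >= Mp on the new one. *)
Lemma lyapunov_decrease k : Mp * tau.+2%:R <= alpha^-1 -> (0 < k)%N ->
  V k.+1 <= V k - Mp * delta k.+1 ^+ 2.
Proof.
move=> aM k0; have := descent k0; rewrite /V lyapS.
set D := delta k.+1; set S := \sum_(s < tau) delta (k - s)%N.
set Q := \sum_(s < tau) _ ^+ 2 => H.
have amgm : D * S <= (tau%:R * D ^+ 2 + Q) / 2.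
  have -> : tau%:R * D ^+ 2 + Q = \sum_(s < tau) (D ^+ 2 + delta (k - s)%N ^+ 2).
    by rewrite big_split sumr_const card_ord mulr_natl.
  rewrite mulr_sumr mulr_suml; apply: ler_sum => s _.
  by have := sqr_ge0 (D - delta (k - s)%N); rewrite sqrrB; lra.
have H1 := ler_wpM2l Mp_ge0 amgm.
have H2 := ler_wpM2r (sqr_ge0 D) aM.
have t2E : tau.+2%:R = tau%:R + 2 :> R by rewrite -natrD addn2.
by move: H2; rewrite t2E; lra.
Qed.

Let S k := \sum_(s < tau.+1) delta (k - s)%N.

Lemma residual_vector_le k :
  enorm (grad p (xs k.+1) + v k) <= (Mp + alpha^-1) * S k.+1.
Proof.
have SE : S k.+1 = delta k.+1 + \sum_(s < tau) delta (k - s)%N.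
  by rewrite /S big_ord_recl subn0.
have a0 : 0 <= alpha^-1 by rewrite invr_ge0 ltW.
rewrite /v opprD addrA (le_trans (ler_enormD _ _)) // enormN enormZ ger0_norm //.
rewrite mulrDl lerD //.
  by rewrite SE; exact: aggregated_gradient_error.
by rewrite ler_wpM2l // SE lerDl sumr_ge0.
Qed.

Lemma S_ge0 k : 0 <= S k. Proof. exact: sumr_ge0. Qed.

(** * Error bound, separation and the linear rate *)

Section LinearRate.
Variables (L : R) (L_gt0 : 0 < L) (Mp_gt0 : 0 < Mp).
Hypothesis alpha_small : Mp * tau.+2%:R <= alpha^-1.
Hypothesis F_bounded : bounded_below (objective p h).
Hypothesis error_bound : proximal_error_bound L p h.
Hypothesis separation : stationary_separation p h.

Let Fx_le_V k : Fx k <= V k.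
Proof. by rewrite /V lerDl mulr_ge0 ?lyap_ge0 // divr_ge0. Qed.

Let V_le k n : (0 < k)%N -> (k <= n)%N -> V n <= V k.
Proof.
move=> k0 /subnKC <-; elim: (n - k)%N => [|m IH]; first by rewrite addn0.
rewrite addnS (le_trans (lyapunov_decrease alpha_small _)) ?addn_gt0 ?k0 //.
by apply: le_trans IH; rewrite gerBl mulr_ge0 ?sqr_ge0.
Qed.

Let S_vanish r : 0 < r -> exists n, forall k, (n <= k)%N -> S k < r.
Proof.
apply: window_vanish => {}r r0; have [m mF] := F_bounded.
apply: (@sufficient_decrease_vanish _ V delta Mp m 1) => // k k0.
  exact: lyapunov_decrease.
rewrite (le_trans _ (Fx_le_V k)) // -lee_fin /Fx objective_fine ?piag_fin //=.
by rewrite -objective_fine ?piag_fin.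
Qed.

Lemma near_stationary : exists c n, 0 <= c /\ forall k, (n <= k)%N ->
  exists2 y, stationary p h y & enorm (xs k - y) <= c * S k.
Proof.
(* [V] decreases from index 1 on and dominates the objective, so one level, hence one pair of
   constants, serves all later iterates. *)
have [|eps [c0 [eps0 c00 H]]] := error_bound (zeta := V 1).
  apply: ge_ereal_inf; exists (objective p h (xs 1)); first by exists (xs 1).
  have /fineK <- : objective p h (xs 1) \is a fin_num.
    by rewrite objective_fine // piag_fin.
  by rewrite lee_fin Fx_le_V.
pose E := Mp + alpha^-1.
have E0 : 0 < E by rewrite addr_gt0 ?invr_gt0.
have EL : 0 < L^-1 * E by rewrite mulr_gt0 ?invr_gt0.
have [|n Hn] := S_vanish (r := eps / (L^-1 * E)); first by rewrite divr_gt0.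
(* The distance is an infimum that need not be attained a priori; the factor 2 leaves strict room to
   pick a point. *)
exists (2 * (c0 * (L^-1 * E))), n.+1.
split; first by rewrite !mulr_ge0 ?(ltW c00) ?(ltW EL) ?(ltW E0) // invr_ge0 ltW.
case=> // k; rewrite ltnS => nk.
(* With a zero window there is no strict room, but then the residual vector vanishes and the iterate
   itself is stationary. *)
have [S0|SN0] := eqVneq (S k.+1) 0.
  exists (xs k.+1); last by rewrite subrr enorm0 S0 mulr0.
  exists (v k); first exact: piag_subdiff.
  apply/enorm_eq0/le_anti; rewrite enorm_ge0 andbT.
  by rewrite (le_trans (residual_vector_le k)) // S0 mulr0.
have S0 : 0 < S k.+1 by rewrite lt_neqAle eq_sym SN0 S_ge0.
have res : prox_residual L p h (xs k.+1) <= L^-1 * E * S k.+1.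
  apply: le_trans (prox_residual_le p L_gt0 h_proper h_lsc h_convex (piag_subdiff k)) _.
  by rewrite -mulrA ler_wpM2l ?invr_ge0 ?(ltW L_gt0) // residual_vector_le.
have [|y Xy xy] :=
    @edist_lt _ _ (xs k.+1) (stationary p h) (2 * (c0 * (L^-1 * E)) * S k.+1).
  apply: (@le_lt_trans _ _ (c0 * prox_residual L p h (xs k.+1))%:E).
    apply: H.
      rewrite (le_lt_trans res) // mulrC -ltr_pdivlMr // Hn //.
      exact: leqW.
    have /fineK <- : objective p h (xs k.+1) \is a fin_num.
      by rewrite objective_fine // piag_fin.
    by rewrite lee_fin (le_trans (Fx_le_V _)) // V_le.
  rewrite lte_fin; apply: (@le_lt_trans _ _ (c0 * (L^-1 * E * S k.+1))).
    by rewrite ler_wpM2l // ltW.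
  rewrite -!mulrA ltr_pMl ?ltr1n // !mulr_gt0 ?invr_gt0 //.
by exists y => //; exact: ltW.
Qed.

Lemma piag_increments_geometric :
  exists A q, [/\ 0 <= A, 0 < q < 1 & forall k, delta k <= A * q ^+ k].
Proof.
have [c [n [c0 Hn]]] := near_stationary.
have /choice[y Hy] : forall k, exists y, (n <= k)%N ->
    stationary p h y /\ enorm (xs k - y) <= c * S k.
  move=> k; have [/Hn[y Xy xy]|_] := leqP n k; first by exists y.
  by exists 0.
have [delta0 delta0_gt0 Hsep] := separation.
(* Successive stationary points satisfy |y_(k+1) - y_k| <= c S_(k+1) + delta_(k+1) + c S_k, which
   this threshold keeps below [delta0]. *)
have [|n' Hn'] := S_vanish (r := delta0 / (2 * c + 1)).
  by rewrite divr_gt0 // ltr_wpDl // mulr_ge0.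
pose K := maxn 1 (maxn n n').
have K1 k : (K <= k)%N -> (0 < k)%N by rewrite !geq_max => /and3P[].
have Kn k : (K <= k)%N -> (n <= k)%N by rewrite !geq_max => /and3P[].
have Kn' k : (K <= k)%N -> (n' <= k)%N by rewrite !geq_max => /and3P[].
have delta_S k : delta k <= S k.
  by rewrite /S big_ord_recl subn0 lerDl sumr_ge0.
pose Fy k := fine (objective p h (y k)).
have FyS k : (K <= k)%N -> Fy k.+1 = Fy k.
  move=> Kk; have [Xk xk] := Hy _ (Kn _ Kk).
  have [Xk' xk'] := Hy _ (leqW (Kn _ Kk)).
  apply: contrapT => FyN.
  have : objective p h (y k.+1) <> objective p h (y k).
    by move=> E; apply: FyN; rewrite /Fy E.
  move=> /(Hsep _ _ Xk' Xk); apply/negP; rewrite -ltNge.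
  have H1 := Hn' _ (Kn' _ Kk); have H2 := Hn' _ (leqW (Kn' _ Kk)).
  have H3 := ler_enormB_trans (xs k.+1) (y k.+1) (y k).
  have H4 := ler_enormB_trans (xs k) (xs k.+1) (y k).
  have H5 := delta_S k.+1.
  rewrite (enormBC (y k.+1) (xs k.+1)) in H3; rewrite -/(delta k.+1) in H4.
  have H6 := ler_wpM2l c0 (ltW H1); have H7 := ler_wpM2l c0 (ltW H2).
  have : (2 * c + 1) * (delta0 / (2 * c + 1)) = delta0.
    by rewrite mulrC divfK // gt_eqF // ltr_wpDl // mulr_ge0.
  move: (delta0 / _) H1 H2 H6 H7 => rho H1 H2 H6 H7 H8.
  lra.
pose Fs := Fy K.
have FyE k : (K <= k)%N -> Fy k = Fs.
  move=> /subnKC <-; elim: (k - K)%N => [|m IH]; first by rewrite addn0.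
  by rewrite addnS FyS // leq_addr.
have xy2 k : (K <= k)%N -> enorm (xs k - y k) ^+ 2 <= c ^+ 2 * S k ^+ 2.
  move=> Kk; have [_ xk] := Hy _ (Kn _ Kk).
  by rewrite -exprMn ler_pXn2r ?nnegrE ?enorm_ge0 // mulr_ge0 // S_ge0.
(* If V_k < Fs, then F(x_m) <= V_k for all m >= k, contradicting F(x_m) >= Fs - Mp c^2 S_m^2 once
   S_m is small. Taking S_m < 1 as well allows S_m^2 to be replaced by S_m. *)
have VFs k : (K <= k)%N -> Fs <= V k.
  move=> Kk; rewrite leNgt; apply/negP => VF.
  have B0 : 0 < Mp * c ^+ 2 + 1 by rewrite ltr_wpDl // mulr_ge0 ?sqr_ge0.
  have [|n1 H1] := S_vanish (r := (Fs - V k) / (Mp * c ^+ 2 + 1)).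
    by rewrite divr_gt0 // subr_gt0.
  have [n2 H2] := S_vanish (r := 1) ltr01.
  pose m := maxn k (maxn n1 n2).
  have km : (k <= m)%N by rewrite leq_maxl.
  have /H1 S1 : (n1 <= m)%N by rewrite /m !leq_max leqnn orbT.
  have /H2 S2 : (n2 <= m)%N by rewrite /m !leq_max leqnn !orbT.
  have Km := leq_trans Kk km.
  have [Xm _] := Hy _ (Kn _ Km).
  have := stationary_fine_objective_le Mp_ge0 p_smooth h_proper Xm (h_lt (K1 _ Km)).
  rewrite -/(Fy m) FyE // => H3.
  have H4 := ler_wpM2l Mp_ge0 (xy2 _ Km).
  have := le_trans (Fx_le_V m) (V_le (K1 _ Kk) km); rewrite /Fx => H5.
  move: S1; rewrite ltr_pdivlMr // => S1.
  have H6 : S m ^+ 2 <= S m by rewrite expr2 ler_piMr ?S_ge0 // ltW.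
  have Mc : 0 <= Mp * c ^+ 2 by rewrite mulr_ge0 ?sqr_ge0.
  have := ler_wpM2l Mc H6; have := S_ge0 m; move: H4; rewrite mulrA; lra.
pose Q k := \sum_(s < tau.+1) delta (k - s)%N ^+ 2.
have Q_ge0 k : 0 <= Q k by apply: sumr_ge0 => s _; exact: sqr_ge0.
(* [c1] bounds F(x_(k+1)) - Fs in terms of S_(k+1)^2; then S^2 <= (tau + 1) Q and lyap <= tau Q give
   [C]. *)
pose c1 := (Mp + alpha^-1) * c + Mp * c ^+ 2.
have a0 : 0 < alpha^-1 by rewrite invr_gt0.
have c10 : 0 <= c1 by rewrite addr_ge0 // mulr_ge0 ?sqr_ge0 // addr_ge0 // ltW.
pose C := c1 * tau.+1%:R + Mp / 2 * tau%:R.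
have ub k : (K <= k)%N -> V k.+1 - Fs <= C * Q k.+1.
  move=> Kk; have [Xk xk] := Hy _ (leqW (Kn _ Kk)).
  have hy : (h (y k.+1) < +oo)%E by rewrite ltey_eq (stationary_fin h_proper Xk).
  have := fine_objective_le_near Mp_ge0 p_smooth h_proper (piag_subdiff k) hy.
  rewrite -/(Fx k.+1) -/(Fy k.+1) (FyE _ (leqW Kk)) => H1.
  have H2 : enorm (grad p (xs k.+1) + v k) * enorm (xs k.+1 - y k.+1) <=
      (Mp + alpha^-1) * S k.+1 * (c * S k.+1).
    by apply: ler_pM; rewrite ?enorm_ge0 // residual_vector_le.
  have H3 := ler_wpM2l Mp_ge0 (xy2 _ (leqW Kk)).
  have H4 := ler_wpM2l c10 (sqr_sum_le (fun s : 'I_tau.+1 => delta (k.+1 - s)%N)).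
  have H5 : lyap k.+1 <= tau%:R * Q k.+1.
    rewrite /Q big_ord_recr /= mulrDr ler_wpDr ?mulr_ge0 ?sqr_ge0 //.
    rewrite mulr_sumr; apply: ler_sum => s _; rewrite ler_wpM2r ?sqr_ge0 //.
    by rewrite ler_nat leq_subr.
  have M20 : 0 <= Mp / 2 by rewrite divr_ge0.
  have H6 := ler_wpM2l M20 H5.
  move: H4; rewrite -/(S k.+1) -/(Q k.+1) /C /V /c1; move: H1 H2 H3 H6.
  move: (S k.+1) (Q k.+1) => T U; lra.
have [||||A [q [A0 q01 dA]]] :=
    @sufficient_decrease_linear _ (fun k => V k - Fs) delta Mp C K tau Mp_gt0.
- by rewrite addr_ge0 // mulr_ge0 // divr_ge0.
- by move=> k Kk; rewrite subr_ge0 VFs.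
- move=> k Kk; have := lyapunov_decrease alpha_small (K1 _ Kk); lra.
- exact: ub.
by exists A, q; split=> // k; rewrite (le_trans (ler_norm _)).
Qed.

End LinearRate.
End Iterates.

(** * Stepsize threshold and conclusion *)

Theorem theorem2 (R : realType) (d N : nat)
  (f : 'I_N -> 'rV[R]_d -> R) (h : 'rV[R]_d -> \bar R)
  (L l : 'I_N -> R) (tau : nat)
  (fdiff : forall i x, differentiable (f i) x)
  (L_pos : 0 < \sum_(i < N) L i)
  (A0 : bounded_below (objective (fun x => \sum_(i < N) f i x) h))
  (A1 : forall i, [/\ 0 <= l i, l i <= L i & smooth_dc (L i) (l i) (f i)])
  (A2 : [/\ eproper h, lower_semicontinuous h, econvex h &
            forall x, (h x < +oo)%E -> subdiff h x !=set0])
  (A4 : proximal_error_bound (\sum_(i < N) L i)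
          (fun x => \sum_(i < N) f i x) h)
  (A5 : stationary_separation (fun x => \sum_(i < N) f i x) h) :
  exists2 alpha_max : R, 0 < alpha_max &
  forall alpha : R, 0 < alpha <= alpha_max ->
  forall (delay : nat -> 'I_N -> nat) (xs : nat -> 'rV[R]_d),
    (forall k i, (1 <= k)%N -> (delay k i <= tau)%N) ->
    piag f h alpha delay xs ->
    (\sum_(0 <= i <oo) (enorm (xs i.+1 - xs i))%:E < +oo)%E /\
    R_linearly_convergent xs.
Proof.
have f_smooth i : is_smooth (L i + l i) (f i).
  by have [_ _] := A1 i; exact: smooth_dc_smooth.
have M_ge0 i : 0 <= L i + l i.
  by have [l0 lL _] := A1 i; rewrite addr_ge0 // (le_trans l0).
have [h_proper h_lsc h_convex _] := A2.
pose Mp := \sum_(i < N) (L i + l i).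
have Mp_gt0 : 0 < Mp.
  rewrite (lt_le_trans L_pos) //; apply: ler_sum => i _.
  by have [l0 _ _] := A1 i; rewrite lerDl.
have D0 : 0 < Mp * tau.+2%:R by rewrite mulr_gt0.
(* The threshold depends only on the smoothness constants and [tau], so it is fixed before the
   delays and the sequence. *)
exists (Mp * tau.+2%:R)^-1; first by rewrite invr_gt0.
move=> alpha /andP[alpha0 alpha_le] delay xs delay_le xs_piag.
have alpha_small : Mp * tau.+2%:R <= alpha^-1.
  by rewrite -[leLHS]invrK lef_pV2 // posrE invr_gt0.
have [A [q [A_ge0 q01 dA]]] := piag_increments_geometric M_ge0 f_smooth h_proper h_lsc
  h_convex alpha0 delay_le xs_piag L_pos Mp_gt0 alpha_small A0 A4 A5.
have Aq0 : 0 <= A * q by case/andP: q01 => q0 _; rewrite mulr_ge0 // ltW.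
(* The increment from k to k + 1 is delta_(k+1), whence the extra factor [q] in the constant. *)
have xsA k : enorm (xs k.+1 - xs k) <= A * q * q ^+ k by rewrite -mulrA -exprS; exact: dA.
split; first exact: geometric_enorm_summable Aq0 q01 xsA.
exact: geometric_R_linearly_convergent Aq0 q01 xsA.
Qed.
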